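(* For every integer $k\ge 0$, $|\mathcal{U}_{2k+1}(231,1423)|=\frac{1}{2k+1}\binom{3k}{k}$.
   Context: West's stack-sorting map $s$ is defined recursively on finite sequences of distinct positive integers: $s$ sends the empty sequence to itself, and if $\pi$ is a nonempty such sequence with largest entry $n$, writing $\pi=LnR$ one sets $s(\pi)=s(L)s(R)n$. A permutation $\pi\in S_n$ (one-line notation) is uniquely sorted if exactly one permutation $\sigma\in S_n$ satisfies $s(\sigma)=\pi$. Let $\mathcal{U}_n$ be the set of uniquely sorted permutations in $S_n$. A permutation $\pi$ contains a pattern $\tau\in S_m$ if some subsequence of $\pi$ of length $m$ has its entries in the same relative order as $\tau$; otherwise $\pi$ avoids $\tau$. $\mathcal{U}_{n}(\tau^{(1)},\dots,\tau^{(\ell)})$ denotes the set of permutations in $\mathcal{U}_n$ avoiding all of $\tau^{(1)},\dots,\tau^{(\ell)}$. *)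

(* Defs.v *)
From mathcomp Require Import all_boot all_order all_algebra all_fingroup.

Set Implicit Arguments.
Unset Strict Implicit.
Unset Printing Implicit Defensive.

Definition max_entry (w : seq nat) : nat := \max_(x <- w) x.

(* The recursion L n R |-> s(L) s(R) n is not structural, so it is run with
   [fuel]; any fuel >= size w gives the same result ([stack_sort_rec_fuel]), and
   [stack_sort_nil], [stack_sort_cat] are the two defining equations of s. *)
Fixpoint stack_sort_rec (fuel : nat) (w : seq nat) : seq nat :=
  if fuel is fuel'.+1 then
    if w is [::] then [::]
    else
      let n := max_entry w in
      let L := take (index n w) w in
      let R := drop (index n w).+1 w in
      stack_sort_rec fuel' L ++ stack_sort_rec fuel' R ++ [:: n]
  else [::].

Definition stack_sort (w : seq nat) : seq nat := stack_sort_rec (size w) w.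

Lemma stack_sort_rec_fuel f g (w : seq nat) :
  size w <= f -> size w <= g -> stack_sort_rec f w = stack_sort_rec g w.
Proof.
elim: f g w => [|f IHf] [|g] [|x w] // hf hg.
have hi : index (max_entry (x :: w)) (x :: w) <= size w.
  rewrite -ltnS -[(size w).+1]/(size (x :: w)) index_mem /max_entry.
  elim: w x {hf hg} => [|y w IHw] x; first by rewrite big_seq1 mem_head.
  rewrite big_cons; case: (leqP x (\max_(z <- y :: w) z)) => _.
    by rewrite in_cons IHw orbT.
  by rewrite mem_head.
rewrite [LHS]/stack_sort_rec -/stack_sort_rec.
rewrite [RHS]/stack_sort_rec -/stack_sort_rec.
move: (index _ _) hi => i hi.
have hL h : size w <= h -> size (take i (x :: w)) <= h.
  by apply: leq_trans; rewrite size_take_min geq_min hi.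
have hR h : size w <= h -> size (drop i.+1 (x :: w)) <= h.
  by apply: leq_trans; rewrite size_drop subSS leq_subr.
rewrite (IHf g (take _ _)) ?(IHf g (drop _ _)) //; by [apply: hL | apply: hR].
Qed.

Lemma stack_sort_nil : stack_sort [::] = [::].
Proof. by []. Qed.

Lemma stack_sort_cat (L R : seq nat) (n : nat) :
  all (fun x => x < n) (L ++ R) ->
  stack_sort (L ++ n :: R) = stack_sort L ++ stack_sort R ++ [:: n].
Proof.
rewrite all_cat => /andP[hL hR].
have hmax : max_entry (L ++ n :: R) = n.
  apply/eqP; rewrite eqn_leq; apply/andP; split.
    apply/bigmax_leqP_seq => x; rewrite mem_cat in_cons => hx _.
    case/or3P: hx => [/(allP hL)/ltnW //|/eqP-> //|/(allP hR)/ltnW //].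
  by apply: leq_bigmax_seq => //; rewrite mem_cat mem_head orbT.
have hnL : n \notin L by apply/negP => /(allP hL); rewrite ltnn.
have hidx : index n (L ++ n :: R) = size L.
  by rewrite index_cat (negbTE hnL) /= eqxx addn0.
have -> : stack_sort (L ++ n :: R) =
    stack_sort_rec (size (L ++ n :: R)).-1 L ++
    stack_sort_rec (size (L ++ n :: R)).-1 R ++ [:: n].
  rewrite /stack_sort size_cat /= addnS /= hmax hidx take_size_cat //.
  rewrite -cat_rcons drop_size_cat ?size_rcons //.
  by case: L {hL hmax hnL hidx}.
rewrite size_cat /= addnS /=; congr (_ ++ _); last congr (_ ++ _);
  by apply: stack_sort_rec_fuel; rewrite ?leq_addr ?leq_addl.
Qed.

(* Permutations of 'I_n act on {0, ..., n-1}; entries are shifted to {1, ..., n}. *)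
Definition one_line (n : nat) (p : 'S_n) : seq nat :=
  [seq (p i).+1 | i <- enum 'I_n].

Definition uniquely_sorted (n : nat) (p : 'S_n) : bool :=
  #|[set q : 'S_n | stack_sort (one_line q) == one_line p]| == 1.

Definition same_order (u v : seq nat) : bool :=
  (size u == size v) &&
  [forall i : 'I_(size u), forall j : 'I_(size u),
     (nth 0 u i < nth 0 u j) == (nth 0 v i < nth 0 v j)].

(* [mask m w], for m a sequence of bits of the same length as w, ranges over
   the subsequences of w. *)
Definition contains (w tau : seq nat) : bool :=
  [exists m : (size w).-tuple bool, same_order (mask m w) tau].

Definition uniquely_sorted_avoiding (n : nat) (taus : seq (seq nat)) : {set 'S_n} :=
  [set p : 'S_n | uniquely_sorted p &
     all (fun tau => ~~ contains (one_line p) tau) taus].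

(* Main.v *)
Require Import Defs.
From HB Require Import structures.
From mathcomp Require Import all_boot all_order all_algebra all_fingroup.
From mathcomp Require Import zify.

(* A nonempty word with distinct entries has exactly one preimage under s iff it is
   tight: it is a single entry, or A B n with n its largest entry, A and B tight
   and a descent from A to B. Indeed every nonempty sorted word has at most
   (size - 1) / 2 descents, tight words are those reaching the bound, and
   counting descents shows that the splitting A B n is unique.

   Permutations avoiding 231 are the preorder readings of postorder labellings
   of ordered forests. On forests, the splitting A B n reads
   (A', leaf), (T B) |-> A' Node(T) B leaf, with T nonempty; such a forest
   avoids 1423 iff either A' is empty and T B avoids 1423, or A', leaf avoids
   1423, T is one tree and T B is a list of chains. In the second case T B is
   one of the Catalan many tight lists of k + 1 chains with 2k + 1 nodes.
   With t marking the number of trees and C the Catalan series, this gives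
     U(t) = t + x t^2 (U(t) - U(1)) / (t - 1) + x t C(x t) (U(t) - t),
   which the kernel method solves at t = C(x t) = T, where T = 1 + x T^3, with
   U(1) = T. Here the kernel method takes the form of a weight h(n, c),
   the coefficient of x^n in T^(c + 1), which counts the descendants of size n
   of a forest with c trees. *)

Set Implicit Arguments.
Unset Strict Implicit.
Unset Printing Implicit Defensive.

Lemma cat_eq_split (T : Type) (A B C D : seq T) :
  A ++ B = C ++ D -> size A <= size C -> exists E, C = A ++ E /\ B = E ++ D.
Proof.
elim: A C => [|x A IHA] [|y C] //=; first by move=> -> _; exists [::].
  by move=> -> _; exists (y :: C).
by case=> -> /IHA h /h[E [-> ->]]; exists E.
Qed.

(** * Stack-sorting and descents *)

Lemma cons_neq0 (T : Type) (x : T) s : x :: s <> [::].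
Proof. by []. Qed.

Lemma cat_injl (T : eqType) (A B C : seq T) : C ++ A = C ++ B -> A = B.
Proof. by move/eqP; rewrite eqseq_cat // eqxx => /eqP. Qed.

Lemma cat_injr (T : eqType) (A B C : seq T) : A ++ C = B ++ C -> A = B.
Proof.
move=> e; have /eqP := congr1 size e; rewrite !size_cat eqn_add2r => /eqP sz.
by move/eqP: e; rewrite eqseq_cat // eqxx andbT => /eqP.
Qed.

Fixpoint des (w : seq nat) : nat :=
  if w is x :: v then (head x v < x) + des v else 0.

Lemma des_cat (A B : seq nat) :
  des (A ++ B) = des A + (head (last 0 A) B < last 0 A) + des B.
Proof.
elim: A => [|x [|y A] IHA] //=; first by rewrite ltnn.
by move: IHA => /= ->; rewrite !addnA.
Qed.

Lemma des_rcons_max (w : seq nat) n : all (fun x => x < n) w -> des (rcons w n) = des w.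
Proof.
move=> h; rewrite -cats1 des_cat /= ltnn addn0.
case: (lastP w) h => [|v x] //; rewrite last_rcons all_rcons => /andP[hx _].
by rewrite ltnNge (ltnW hx) !addn0.
Qed.

(** The recursion of [s] read on its outputs: every image of a word with distinct entries has this
    form, and every word of this form is an image. [A] or [B] may be empty. *)
Inductive sorted_word : seq nat -> Prop :=
| sorted_word_nil : sorted_word [::]
| sorted_word_node A B n : all (fun x => x < n) (A ++ B) ->
    sorted_word A -> sorted_word B -> sorted_word (rcons (A ++ B) n).

Inductive tight_word : seq nat -> Prop :=
| tight_word_one n : tight_word [:: n]
| tight_word_node A B n : all (fun x => x < n) (A ++ B) ->
    tight_word A -> tight_word B -> head 0 B < last 0 A ->
    tight_word (rcons (A ++ B) n).

Lemma tight_word_neq0 w : tight_word w -> w <> [::].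
Proof. by case=> [n|A B n _ _ _ _] //; case: (A ++ B). Qed.

Lemma tight_sorted w : tight_word w -> sorted_word w.
Proof.
elim=> [n|A B n h _ sA _ sB _]; last exact: sorted_word_node.
exact: (@sorted_word_node [::] [::] n isT sorted_word_nil sorted_word_nil).
Qed.

Lemma head_any (T : Type) (x y : T) (s : seq T) : s <> [::] -> head x s = head y s.
Proof. by case: s. Qed.

(** Nonempty [A] and [B] bring at most (|A| - 1)/2 and (|B| - 1)/2 descents, their junction at most
    one, and the final maximum none. *)
Lemma sorted_word_des w : sorted_word w -> w <> [::] -> (des w).*2 < size w.
Proof.
elim=> [|A B n h sA IHA sB IHB] // _.
rewrite (des_rcons_max h) size_rcons size_cat des_cat.
case: A IHA {h sA} => [|x A] IHA; case: B IHB {sB} => [|y B] IHB //.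
- by move: (IHB (@cons_neq0 _ _ _)) => /=; lia.
- by move: (IHA (@cons_neq0 _ _ _)) => /=; rewrite ltnn; lia.
- by move: (IHA (@cons_neq0 _ _ _)) (IHB (@cons_neq0 _ _ _)) => /=; lia.
Qed.

Lemma tight_word_des w : tight_word w -> size w = (des w).*2.+1.
Proof.
elim=> [n|A B n h tA IHA tB IHB d] /=; first by rewrite ltnn.
rewrite (des_rcons_max h) size_rcons size_cat des_cat.
by rewrite (head_any _ 0 (tight_word_neq0 tB)) d IHA IHB; lia.
Qed.

(** Doubling descents, each nonempty part falls short of its size by at least one and the junction
    recovers at most two, so the hypothesis forces equality everywhere. *)
Lemma sorted_cat_des A B : sorted_word A -> sorted_word B ->
  A ++ B <> [::] -> size (A ++ B) <= (des (A ++ B)).*2 ->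
  [/\ A <> [::], B <> [::], head 0 B < last 0 A,
      size A = (des A).*2.+1 & size B = (des B).*2.+1].
Proof.
move=> /sorted_word_des dA /sorted_word_des dB.
rewrite size_cat des_cat.
case: A dA => [|x A] dA; case: B dB => [|y B] dB //.
- by move: (dB (@cons_neq0 _ _ _)) => /=; lia.
- by move: (dA (@cons_neq0 _ _ _)) => /=; rewrite ltnn; lia.
- by move: (dA (@cons_neq0 _ _ _)) (dB (@cons_neq0 _ _ _)) => /=; case: (ltnP y (last x A)) => _; split=> //; lia.
Qed.

Lemma sorted_tight w : sorted_word w -> size w = (des w).*2.+1 -> tight_word w.
Proof.
elim=> [|A B n h sA IHA sB IHB] //.
rewrite (des_rcons_max h) size_rcons => -[e].
case: (eqVneq (A ++ B) [::]) => [->|/eqP nz]; first exact: tight_word_one.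
have [|_ _ d eA eB] := sorted_cat_des sA sB nz; first by rewrite e.
by apply: tight_word_node; [|exact: IHA|exact: IHB|].
Qed.

(** Induction on the tight word [A B n] by the place of the cut: inside [A] or inside [B] the
    induction hypothesis applies, at the end of [A] the count is exact, and a cut just before [n] is
    no descent. *)
Lemma tight_prefix_des w P Q : tight_word w -> w = P ++ Q -> Q <> [::] ->
  P <> [::] -> head 0 Q < last 0 P -> size P <= (des P).*2.+1.
Proof.
move=> tw; elim: tw P Q => [n|A B n h tA IHA tB IHB d] P Q.
  by case: P => [|x [|y P]] //; case: Q.
move=> e Q0 P0 dPQ; rewrite rcons_cat in e.
case: (ltngtP (size P) (size A)) => [lt|lt|eq].
- have [E [eA eQ]] := cat_eq_split (esym e) (ltnW lt).
  have E0 : E <> [::] by move=> E0; move: lt; rewrite eA E0 cats0 ltnn.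
  by apply: (IHA P E eA) => //; move: dPQ; rewrite eQ; case: (E) E0.
- have [P2 [eP eB]] := cat_eq_split e (ltnW lt).
  have P20 : P2 <> [::] by move=> E0; move: lt; rewrite eP E0 cats0 ltnn.
  case: (lastP Q) eB Q0 dPQ {e} => [|Q' m] // e _; rewrite -rcons_cat in e.
  have [eB em] := rcons_inj e; subst m.
  case: Q' eB {e} => [|q Q'] eB /=.
    have : last 0 P \in A ++ B.
      rewrite cats0 in eB; rewrite eB -eP.
      by case: (P) P0 => // x P' _; rewrite /= mem_last.
    by move=> /(allP h) l1 l2; move: (ltn_trans l1 l2); rewrite ltnn.
  have lP : last 0 P = last 0 P2 by rewrite eP last_cat; case: (P2) P20.
  rewrite lP => dd; have h2 := IHB _ _ eB (@cons_neq0 _ _ _) P20 dd.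
  rewrite eP size_cat des_cat (tight_word_des tA).
  have -> : head (last 0 A) P2 = head 0 B by rewrite eB; case: (P2) P20.
  by rewrite d; lia.
- have [E [eP eB]] := cat_eq_split e (eq_leq (esym eq)).
  have E0 : E = [::] by apply: size0nil; move: eq; rewrite eP size_cat; lia.
  by rewrite eP E0 cats0 (tight_word_des tA).
Qed.

(** Tightness of [A] and [A E] gives [E] exactly 2 des(E) + 2 entries, one more than a prefix of the
    tight word [E B] ending at a descent may have. *)
Lemma tight_overlap A E B : tight_word A -> tight_word (A ++ E) ->
  tight_word (E ++ B) -> tight_word B -> E <> [::] ->
  head 0 E < last 0 A -> head 0 B < last 0 E -> False.
Proof.
move=> tA tAE tEB tB E0 d1 d2.
have := tight_prefix_des tEB erefl (tight_word_neq0 tB) E0 d2.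
have := tight_word_des tAE; rewrite des_cat size_cat (tight_word_des tA).
by rewrite (head_any _ 0 E0) d1; lia.
Qed.

(** The word has enough descents to put [C] and [D] in the equality case, so both splittings cut it
    into tight words at a descent. Two different cuts would enclose a nonempty word excluded by
    [tight_overlap]. *)
Lemma tight_split_unique A B C D : tight_word A -> tight_word B ->
  head 0 B < last 0 A -> sorted_word C -> sorted_word D ->
  A ++ B = C ++ D -> C = A /\ D = B.
Proof.
move=> tA tB d sC sD e.
have nAB : A ++ B <> [::].
  by have := tight_word_neq0 tA; case: (A).
have : size (A ++ B) <= (des (A ++ B)).*2.
  rewrite size_cat des_cat (head_any _ 0 (tight_word_neq0 tB)) d.
  by rewrite (tight_word_des tA) (tight_word_des tB); lia.
rewrite e in nAB * => /(sorted_cat_des sC sD nAB)[C0 D0 d' eC eD].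
have {sC eC}tC := sorted_tight sC eC; have {sD eD}tD := sorted_tight sD eD.
(* [X] and [Y] are the shorter and the longer first part and [E] is the piece between the cuts;
   either splitting may be the one cut first. *)
have side X Y E Z : tight_word X -> tight_word Z -> tight_word Y ->
    tight_word (E ++ Z) -> head 0 (E ++ Z) < last 0 X -> head 0 Z < last 0 Y ->
    Y = X ++ E -> E = [::].
  move=> tX tZ tY tEZ d1 d2 eY; case: (eqVneq E [::]) => // /eqP E0; exfalso.
  apply: (tight_overlap tX _ tEZ tZ E0); first by rewrite -eY.
    by move: d1; case: (E) E0.
  by move: d2; rewrite eY last_cat; case: (E) E0.
case: (leqP (size A) (size C)) => [/(cat_eq_split e)|/ltnW/(cat_eq_split (esym e))] [E [e1 e2]].
  have E0 := side A C E D tA tD tC; rewrite -e2 in E0.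
  by rewrite e1 e2 (E0 tB d d' e1) cats0.
have E0 := side C A E B tC tB tA; rewrite -e2 in E0.
by rewrite e1 e2 (E0 tD d' d e1) cats0.
Qed.

Lemma sorted_le_last w x : sorted_word w -> x \in w -> x <= last 0 w.
Proof.
case=> [|A B n h _ _] //; rewrite last_rcons mem_rcons in_cons.
by case/orP=> [/eqP-> //|/(allP h)/ltnW].
Qed.

(** The last entry of a sorted word is its largest, so all of [A] lies below the final [n] of
    [B = B1 B2 n], and [A] is absorbed into [B1]. *)
Lemma sorted_word_cat A B : sorted_word A -> sorted_word B ->
  last 0 A < head 0 B -> sorted_word (A ++ B).
Proof.
move=> sA sB; elim: sB => [|B1 B2 n h s1 IH1 s2 _]; first by rewrite cats0.
move=> d; have hA : all (fun x => x < n) A.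
  apply/allP => x /(sorted_le_last sA) hx; apply: leq_ltn_trans hx (leq_trans d _).
  have : head 0 (rcons (B1 ++ B2) n) \in rcons (B1 ++ B2) n.
    by case: (B1 ++ B2) => [|y s] /=; rewrite mem_head.
  by rewrite mem_rcons in_cons => /orP[/eqP-> //|/(allP h)/ltnW].
rewrite -rcons_cat catA; apply: sorted_word_node => //.
  by rewrite -catA all_cat hA.
by case: B1 {h s1} d IH1 => [|b B1] d IH1; [rewrite cats0|apply: IH1].
Qed.

(** * Preimages under the stack-sorting map *)

Lemma perm_stack_sort w : perm_eq (stack_sort w) w.
Proof.
have := leqnn (size w).
rewrite /stack_sort; move: {2 3}(size w) => f.
elim: f w => [|f IHf] [|x w] // hw.
set v := x :: w; set n := max_entry v.
have nv : n \in v.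
  rewrite /n /v /max_entry; elim: w x {hw v n} => [|y w IHw] x.
    by rewrite big_seq1 mem_head.
  rewrite big_cons; case: (leqP x (\max_(z <- y :: w) z)) => _.
    by rewrite in_cons IHw orbT.
  by rewrite mem_head.
have -> : stack_sort_rec f.+1 v = stack_sort_rec f (take (index n v) v) ++
  stack_sort_rec f (drop (index n v).+1 v) ++ [:: n] by [].
have lti : index n v < size v by rewrite index_mem.
have nthi : nth 0 v (index n v) = n by apply: nth_index.
move: (index n v) lti nthi => i lti nthi.
rewrite -[X in perm_eq _ X](cat_take_drop i) (drop_nth 0 lti) nthi -[n :: _]cat1s.
have pL : perm_eq (stack_sort_rec f (take i v)) (take i v).
  apply: IHf; rewrite size_take_min geq_min; apply/orP; left.
  by rewrite -ltnS; apply: leq_trans lti hw.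
have pR : perm_eq (stack_sort_rec f (drop i.+1 v)) (drop i.+1 v).
  by apply: IHf; rewrite size_drop leq_subLR; apply: leq_trans hw _; rewrite addSn ltnS leq_addl.
by apply: perm_cat => //; rewrite perm_catC perm_cat2l.
Qed.

Lemma max_split (w : seq nat) : uniq w -> w <> [::] ->
  exists L n R, w = L ++ n :: R /\ all (fun x => x < n) (L ++ R).
Proof.
move=> uw w0.
have [n nw hn] : exists2 n, n \in w & all (fun x => x <= n) w.
  elim: w w0 {uw} => [|x [|y w] IHw] // _; first by exists x; rewrite ?mem_head //= leqnn.
  have [//|n nw hn] := IHw; case: (leqP x n) => hx.
    by exists n; [rewrite in_cons nw orbT|rewrite /= hx].
  exists x; first exact: mem_head.
  apply/allP => z; rewrite in_cons => /orP[/eqP-> //|/(allP hn) hz]; apply: leq_trans hz (ltnW hx).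
case/splitPr: nw uw hn => L R uw hn; exists L, n, R; split=> //.
apply/allP => x xLR; rewrite ltn_neqAle; apply/andP; split.
  apply/eqP => xn; move: uw; rewrite -cat1s uniq_catCA cat1s /= -xn xLR //.
by apply: (allP hn); move: xLR; rewrite !mem_cat in_cons => /orP[->|->]; rewrite ?orbT.
Qed.

Lemma stack_sort_node L R n : all (fun x => x < n) (L ++ R) ->
  stack_sort (L ++ n :: R) = rcons (stack_sort L ++ stack_sort R) n.
Proof. by move/stack_sort_cat ->; rewrite -cats1 catA. Qed.

Lemma all_lt_stack_sort L R n :
  all (fun x => x < n) (stack_sort L ++ stack_sort R) = all (fun x => x < n) (L ++ R).
Proof. by apply: perm_all; apply: perm_cat; apply: perm_stack_sort. Qed.

Lemma stack_sort_sorted s : uniq s -> sorted_word (stack_sort s).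
Proof.
have [m] := ubnP (size s); elim: m s => // m IHm s hs us.
case: (eqVneq s [::]) => [->|/eqP s0]; first exact: sorted_word_nil.
have [L [n [R [e h]]]] := max_split us s0.
rewrite e stack_sort_node //.
move: us; rewrite e -cat_rcons cat_uniq rcons_uniq => /and3P[/andP[_ uL] _ uR].
move: hs; rewrite e size_cat /= => hs.
have [hL hR] : size L < m /\ size R < m.
  by rewrite addnS ltnS in hs; split; apply: leq_trans hs; rewrite ltnS ?leq_addr ?leq_addl.
by apply: sorted_word_node; rewrite ?all_lt_stack_sort //; apply: IHm.
Qed.

Lemma sorted_stack_sort w : sorted_word w -> exists s, stack_sort s = w.
Proof.
elim=> [|A B n h _ [L eL] _ [R eR]]; first by exists [::].
by exists (L ++ n :: R); rewrite stack_sort_node ?eL ?eR // -all_lt_stack_sort eL eR.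
Qed.

(** All words are allowed as preimages: a preimage is a rearrangement of [w], so for the one-line
    notation of a permutation it comes from a permutation. *)
Definition unique_preimage (w : seq nat) : Prop :=
  exists2 s, stack_sort s = w & forall t, stack_sort t = w -> t = s.

(** A preimage of [A B n] is [L n R] with [s(L) s(R) = A B]; both images are sorted, so
    [tight_split_unique] gives [s(L) = A] and [s(R) = B], and induction determines [L] and [R]. *)
Lemma tight_unique_preimage w : uniq w -> tight_word w -> unique_preimage w.
Proof.
move=> uw tw; have : exists s, stack_sort s = w by apply/sorted_stack_sort/tight_sorted.
case=> s es; exists s => // t et.
elim: tw uw s t es et => [n|A B n h tA IHA tB IHB d] uw s t es et.
  have one r : stack_sort r = [:: n] -> r = [:: n].
    move=> er; have := perm_stack_sort r; rewrite er perm_sym.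
    exact: perm_small_eq.
  by rewrite (one s es) (one t et).
have preim r : stack_sort r = rcons (A ++ B) n -> exists L R,
    [/\ r = L ++ n :: R, stack_sort L = A & stack_sort R = B].
  move=> er; have pr := perm_stack_sort r; have ur : uniq r by rewrite -(perm_uniq pr) er.
  have r0 : r <> [::] by move=> r0; move: er; rewrite r0 /=; case: (A ++ B).
  have [L [m [R [e hm]]]] := max_split ur r0.
  have uL : uniq L /\ uniq R.
    by move: ur; rewrite e -cat_rcons cat_uniq rcons_uniq => /and3P[/andP[_ ->] _ ->].
  move: er; rewrite e stack_sort_node // => /rcons_inj[e1 e2].
  have [] := tight_split_unique tA tB d (stack_sort_sorted uL.1) (stack_sort_sorted uL.2) (esym e1).
  by move=> eL eR; exists L, R; rewrite -e2.
move: uw; rewrite rcons_uniq cat_uniq => /and4P[_ uA _ uB].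
have [L [R [-> eL eR]]] := preim s es; have [L' [R' [-> eL' eR']]] := preim t et.
by rewrite (IHA uA L L' eL eL') (IHB uB R R' eR eR').
Qed.

Lemma rcons_neq_cons (s : seq nat) n : all (fun x => x < n) s -> s <> [::] ->
  s ++ [:: n] <> n :: s.
Proof. by case: s => // x s /= /andP[hx _] _ [e]; rewrite e ltnn in hx. Qed.

(** Let [L n R] be the preimage. A nonempty [t] with [s(t) = s(L) s(R)] would give two preimages
    [t n] and [n t]. This excludes that exactly one of [L], [R] is empty and, by [sorted_word_cat],
    an ascent at the junction. Uniqueness passes to [L] and [R]. *)
Lemma unique_preimage_tight w : uniq w -> w <> [::] -> unique_preimage w -> tight_word w.
Proof.
have [m] := ubnP (size w); elim: m w => // m IHm w hw uw w0 [s es us].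
have ps := perm_stack_sort s; rewrite es in ps.
have uqs : uniq s by rewrite -(perm_uniq ps).
have s0 : s <> [::] by move=> s0; apply: w0; rewrite -es s0.
have [L [n [R [e h]]]] := max_split uqs s0; subst s.
have hAB : all (fun x => x < n) (stack_sort L ++ stack_sort R) by rewrite all_lt_stack_sort.
rewrite stack_sort_node // in es.
have pL := perm_stack_sort L; have pR := perm_stack_sort R.
have sz (X : seq nat) : stack_sort X = [::] -> X = [::].
  by move=> e; apply: size0nil; rewrite -(perm_size (perm_stack_sort X)) e.
have nosort t : t <> [::] -> stack_sort t = stack_sort L ++ stack_sort R -> False.
  move=> t0 et; have ht : all (fun x => x < n) t.
    by rewrite -(perm_all _ (perm_stack_sort t)) et.
  apply: (rcons_neq_cons ht t0).
  have -> : t ++ [:: n] = L ++ n :: R.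
    by apply: us; rewrite stack_sort_node ?cats0 // et.
  by apply/esym/us; rewrite -(cat0s (n :: t)) stack_sort_node // et.
case: (eqVneq L [::]) => [L0|/eqP L0].
  subst L; case: (eqVneq R [::]) => [R0|/eqP R0]; last by case: (nosort R R0).
  by rewrite -es R0; apply: tight_word_one.
case: (eqVneq R [::]) => [R0|/eqP R0]; first by case: (nosort L L0); rewrite R0 cats0.
move: hw uw; rewrite -es size_rcons size_cat rcons_uniq cat_uniq => hw /and4P[_ uL uLR uR].
have A0 : stack_sort L <> [::] by move/sz.
have B0 : stack_sort R <> [::] by move/sz.
have sA : 0 < size (stack_sort L) by case: (stack_sort L) A0.
have sB : 0 < size (stack_sort R) by case: (stack_sort R) B0.
have tail (X Y Z : seq nat) : Y ++ n :: X = Z ++ n :: X -> Y = Z by move=> /cat_injr.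
apply: tight_word_node => //.
- apply: IHm => //; first lia.
  exists L => // t et; apply: (tail R); apply: us; rewrite stack_sort_node ?et //.
  by rewrite -all_lt_stack_sort et.
- apply: IHm => //; first lia.
  exists R => // t et.
  have : L ++ n :: t = L ++ n :: R.
    apply: us; rewrite stack_sort_node ?et //.
    by rewrite -all_lt_stack_sort et.
  by move/cat_injl => -[].
- rewrite ltnNge; apply/negP => le.
  have ne : last 0 (stack_sort L) != head 0 (stack_sort R).
    apply/eqP => E; move/hasPn: uLR => /(_ (head 0 (stack_sort R))).
    have -> : head 0 (stack_sort R) \in stack_sort R.
      by case: (stack_sort R) B0 => // x v _; rewrite mem_head.
    move=> /(_ isT); rewrite -E; case: (stack_sort L) A0 => // x v _.
    by rewrite /= mem_last.
  have lt : last 0 (stack_sort L) < head 0 (stack_sort R) by rewrite ltn_neqAle ne.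
  have [uL' uR'] : uniq L /\ uniq R by rewrite -(perm_uniq pL) -(perm_uniq pR).
  have [t et] := sorted_stack_sort (sorted_word_cat (stack_sort_sorted uL') (stack_sort_sorted uR') lt).
  apply: (nosort t _ et) => t0; move: et; rewrite t0 stack_sort_nil.
  by case: (stack_sort L) A0.
Qed.

(** * From words to permutations *)

Lemma one_line_inj n : injective (@one_line n).
Proof.
move=> p q /eq_in_map e; apply/permP => i.
by have [] := e i (mem_enum _ i) => /val_inj.
Qed.

Lemma perm_one_line n (p : 'S_n) : perm_eq (one_line p) (iota 1 n).
Proof.
have -> : one_line p = [seq (val i).+1 | i <- [seq p i | i <- enum 'I_n]] by rewrite -map_comp.
have -> : iota 1 n = [seq (val i).+1 | i <- enum 'I_n].
  by rewrite (map_comp S val) val_enum_ord -[1]addn0 iotaDl.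
apply: perm_map; apply: uniq_perm; rewrite ?(map_inj_uniq perm_inj) ?enum_uniq //.
move=> i; rewrite mem_enum; apply/mapP; exists ((p^-1)%g i); rewrite ?mem_enum //.
by rewrite permKV.
Qed.

Lemma one_line_surj n w : perm_eq w (iota 1 n) -> exists p : 'S_n, one_line p = w.
Proof.
move=> pw; have sw : size w = n by rewrite (perm_size pw) size_iota.
have uw : uniq w by rewrite (perm_uniq pw) iota_uniq.
have bnd (i : 'I_n) : (nth 0 w i).-1 < n.
  have : nth 0 w i \in iota 1 n by rewrite -(perm_mem pw) mem_nth ?sw.
  by rewrite mem_iota; lia.
have pos (i : 'I_n) : 0 < nth 0 w i.
  have : nth 0 w i \in iota 1 n by rewrite -(perm_mem pw) mem_nth ?sw.
  by rewrite mem_iota; lia.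
have inj : injective (fun i => Ordinal (bnd i)).
  move=> i j /(congr1 val) /= e; have {}e : nth 0 w i = nth 0 w j.
    by move: e (pos i) (pos j); lia.
  by apply/val_inj/eqP; move/eqP: e; rewrite nth_uniq ?sw.
exists (perm inj); apply: (@eq_from_nth _ 0); rewrite /one_line size_map size_enum_ord // => i hi.
rewrite (nth_map (Ordinal hi)) ?size_enum_ord // permE /=.
by rewrite nth_enum_ord // (prednK (pos (Ordinal hi))).
Qed.

(** Positivity of [n] matters: the empty word has exactly one preimage but is not tight. *)
Lemma uniquely_sortedP n (p : 'S_n) : 0 < n ->
  reflect (tight_word (one_line p)) (uniquely_sorted p).
Proof.
move=> n0; have pp := perm_one_line p.
have uw : uniq (one_line p) by rewrite (perm_uniq pp) iota_uniq.
have w0 : one_line p <> [::].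
  by move=> e; move: n0 (perm_size pp); rewrite e size_iota => /=; lia.
have lift s : stack_sort s = one_line p -> exists q : 'S_n, one_line q = s.
  move=> es; apply: one_line_surj; rewrite -(permPr pp) -es perm_sym.
  exact: perm_stack_sort.
apply: (iffP idP) => [/cards1P[q eq]|/(tight_unique_preimage uw)[s es us]].
  apply: (unique_preimage_tight uw w0); exists (one_line q).
    apply/eqP; have : q \in [set r : 'S_n | stack_sort (one_line r) == one_line p].
    by rewrite eq set11.
  by rewrite inE.
  move=> t et; have [r er] := lift t et.
  have : r \in [set q : 'S_n | stack_sort (one_line q) == one_line p] by rewrite inE er et.
  by rewrite eq inE -er => /eqP->.
have [q eq] := lift s es; apply/cards1P; exists q; apply/setP => r; rewrite !inE.
apply/eqP/eqP => [er|->]; last by rewrite eq.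
by apply: one_line_inj; rewrite eq; apply: us.
Qed.

(** * Pattern containment *)

Lemma same_orderP u v :
  reflect (size u = size v /\ forall i j, i < size u -> j < size u ->
             (nth 0 u i < nth 0 u j) = (nth 0 v i < nth 0 v j))
          (same_order u v).
Proof.
apply: (iffP andP) => [[/eqP sz /forallP h]|[sz h]]; split; rewrite ?sz ?eqxx //.
  move=> i j hi hj; rewrite -sz in hi hj.
  by have /forallP/(_ (Ordinal hj))/eqP := h (Ordinal hi).
by apply/forallP => i; apply/forallP => j; apply/eqP/h; rewrite ?sz ltn_ord.
Qed.

Lemma containsP w tau :
  reflect (exists2 u, subseq u w & same_order u tau) (contains w tau).
Proof.
apply: (iffP existsP) => [[m hm]|[u /subseqP[m sm eu] hu]].
  by exists (mask m w); rewrite ?mask_subseq.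
have st : size m == size w by rewrite sm.
by exists (Tuple st); rewrite /= -eu.
Qed.

Definition av231 (w : seq nat) : Prop :=
  forall x y z, subseq [:: x; y; z] w -> z < x < y -> False.

Definition av312 (w : seq nat) : Prop :=
  forall x y z, subseq [:: x; y; z] w -> y < z < x -> False.

Definition av1423 (w : seq nat) : Prop :=
  forall x y z t, subseq [:: x; y; z; t] w -> x < z < t -> t < y -> False.

Definition av12 (w : seq nat) : Prop :=
  forall x y, subseq [:: x; y] w -> x < y -> False.

Lemma contains231P w : reflect (av231 w) (~~ contains w [:: 2; 3; 1]).
Proof.
apply: (iffP idP) => [/containsP h x y z s lt|h]; last apply/containsP => -[u su /same_orderP[]].
  apply: h; exists [:: x; y; z] => //; apply/same_orderP; split=> // i j.
  by case: i => [|[|[|i]]] //= _; case: j => [|[|[|j]]] //= _; lia.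
case: u su => [|x [|y [|z []]]] // su _ o; apply: (h x y z su).
by rewrite (o 2 0) // (o 0 1).
Qed.

Lemma contains1423P w : reflect (av1423 w) (~~ contains w [:: 1; 4; 2; 3]).
Proof.
apply: (iffP idP) => [/containsP h x y z t s lt1 lt2|h]; last apply/containsP => -[u su /same_orderP[]].
  apply: h; exists [:: x; y; z; t] => //; apply/same_orderP; split=> // i j.
  by case: i => [|[|[|[|i]]]] //= _; case: j => [|[|[|[|j]]]] //= _; lia.
case: u su => [|x [|y [|z [|t []]]]] // su _ o; apply: (h x y z t su).
  by rewrite (o 0 2) // (o 2 3).
by rewrite (o 3 1).
Qed.

Lemma subseq_cat_split (T : eqType) (s A B : seq T) : subseq s (A ++ B) ->
  exists s1 s2, [/\ s = s1 ++ s2, subseq s1 A & subseq s2 B].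
Proof.
case/subseqP => m sm ->; rewrite size_cat in sm.
exists (mask (take (size A) m) A), (mask (drop (size A) m) B); rewrite !mask_subseq.
rewrite -mask_cat ?cat_take_drop // size_takel // sm leq_addr //.
Qed.

(** * Ordered forests and 231-avoiding words *)

Inductive tree : Type := Node of seq tree.

(** Forests are treated as a binary structure: the children [F] of the first root and the trees [G]
    after it, with an induction hypothesis for each. The local fixpoint on lists makes the nested
    recursion structural. *)
Definition tree_cons_rect (P : seq tree -> Type) (P0 : P [::])
    (PS : forall F G, P F -> P G -> P (Node F :: G)) :
    forall t G, P G -> P (t :: G) :=
  fix cons_rect t := match t with
    | Node F => fun G pG =>
      PS F G ((fix go F : P F := match F with
                       | [::] => P0
                       | t' :: G' => cons_rect t' G' (go G')
                       end) F) pG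
    end.

Definition forest_rect (P : seq tree -> Type) (P0 : P [::])
    (PS : forall F G, P F -> P G -> P (Node F :: G)) : forall F, P F :=
  fix go F := match F with
    | [::] => P0
    | t :: G => @tree_cons_rect P P0 PS t G (go G)
    end.

Lemma tree_comparable : comparable tree.
Proof.
suff h : forall F G : seq tree, decidable (F = G).
  move=> [F] [G]; case: (h F G) => [->|ne]; [by left|right].
  by case.
elim/forest_rect => [|F G IHF IHG] [|[F'] G']; try by [left|right].
case: (IHF F') => [->|ne]; last by right; case.
by case: (IHG G') => [->|ne]; [left|right; case].
Qed.

HB.instance Definition _ := hasDecEq.Build tree (compareP tree_comparable).

Definition nodes : seq tree -> nat :=
  @forest_rect (fun=> nat) 0 (fun _ _ nF nG => (nF + nG).+1).

Arguments nodes : simpl never.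

(* The word read off an ordered forest in preorder when the nodes are labelled
   in postorder, starting from m. *)
Definition word (F : seq tree) : nat -> seq nat :=
  @forest_rect (fun=> nat -> seq nat) (fun=> [::])
    (fun F _ wF wG m => m + nodes F :: wF m ++ wG (m + nodes F).+1) F.

Arguments word : simpl never.

Lemma nodes_cons F G : nodes (Node F :: G) = (nodes F + nodes G).+1.
Proof. by []. Qed.

Lemma word_cons F G m :
  word (Node F :: G) m = m + nodes F :: word F m ++ word G (m + nodes F).+1.
Proof. by []. Qed.

Lemma nodes_cat F G : nodes (F ++ G) = nodes F + nodes G.
Proof. by elim/forest_rect: F => // F F' _ IH; rewrite cat_cons !nodes_cons IH addSn addnA. Qed.

Lemma word_cat F G m : word (F ++ G) m = word F m ++ word G (m + nodes F).
Proof.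
elim/forest_rect: F m => [|F F' _ IH] m; first by rewrite addn0.
rewrite cat_cons !word_cons nodes_cons IH cat_cons catA.
by have -> : (m + nodes F).+1 + nodes F' = m + (nodes F + nodes F').+1 by lia.
Qed.

Lemma perm_word F m : perm_eq (word F m) (iota m (nodes F)).
Proof.
elim/forest_rect: F m => [|F G IHF IHG] m //.
rewrite word_cons nodes_cons -(addnS (nodes F)) iotaD /= -cat1s perm_catCA.
by apply: perm_cat => //=; rewrite perm_cons.
Qed.

Lemma mem_word F m x : (x \in word F m) = (m <= x < m + nodes F).
Proof. by rewrite (perm_mem (perm_word F m)) mem_iota. Qed.

Lemma size_word F m : size (word F m) = nodes F.
Proof. by rewrite (perm_size (perm_word F m)) size_iota. Qed.

Lemma uniq_word F m : uniq (word F m).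
Proof. by rewrite (perm_uniq (perm_word F m)) iota_uniq. Qed.

Lemma word_inj F G m : word F m = word G m -> F = G.
Proof.
elim/forest_rect: F G m => [|F G IHF IHG] [|[F'] G'] m //.
rewrite !word_cons => -[/addnI en]; rewrite en => /eqP.
by rewrite eqseq_cat ?size_word // => /andP[/eqP/IHF-> /eqP/IHG->].
Qed.

Lemma word_map F m k : word F (k + m) = map (addn k) (word F m).
Proof.
elim/forest_rect: F m => [|F G IHF IHG] m //.
by rewrite !word_cons /= map_cat -IHF -IHG addnS addnA.
Qed.

(** Sorting [A] and [B] separately and concatenating gives a sorted rearrangement of the interval,
    hence the interval itself. *)
Lemma perm_cat_iota (A B : seq nat) m n : perm_eq (A ++ B) (iota m n) ->
  (forall x y, x \in A -> y \in B -> x <= y) ->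
  perm_eq A (iota m (size A)) /\ perm_eq B (iota (m + size A) (n - size A)).
Proof.
move=> p h; have sz := perm_size p; rewrite size_cat size_iota in sz.
have e : sort leq A ++ sort leq B = iota m n.
  apply: (sorted_eq leq_trans anti_leq); last first.
  - by apply: perm_trans p; apply: perm_cat; rewrite perm_sort.
  - exact: iota_sorted.
  rewrite -[sorted _ _]/(sorted leq (sort leq A ++ sort leq B)) sorted_pairwise; last exact: leq_trans.
  rewrite pairwise_cat -!(sorted_pairwise leq_trans) !(sort_sorted leq_total) !andbT.
  by apply/allrelP => x y; rewrite !mem_sort; apply: h.
have : sort leq A ++ sort leq B = iota m (size A) ++ iota (m + size A) (size B).
  by rewrite e -iotaD sz.
move/eqP; rewrite eqseq_cat ?size_sort ?size_iota // => /andP[/eqP <- /eqP eB].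
by rewrite -sz addKn -eB !(perm_sym _ (sort _ _)) !perm_sort.
Qed.

(** A larger entry of [v] followed by a smaller one would form 231 with [x]. *)
Lemma av231_partition x v : x \notin v -> av231 (x :: v) ->
  v = [seq y <- v | y < x] ++ [seq y <- v | x < y].
Proof.
elim: v => [|y v IH] //; rewrite in_cons negb_or => /andP[ne nv] av.
have av' : av231 (x :: v).
  move=> a b c s; apply: av; apply: (subseq_trans s).
  by rewrite /= eqxx; apply: subseq_cons.
rewrite /=; case: ltngtP ne => // [lt|lt] _; first by rewrite /= -IH.
rewrite (@eq_in_filter _ _ pred0) ?filter_pred0; last first.
  move=> z zv; apply/negP => hz; apply: (av x y z); last by rewrite hz lt.
  by rewrite /= !eqxx sub1seq.
congr (_ :: _); apply/esym/all_filterP/allP => z zv; rewrite ltn_neqAle leqNgt.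
apply/andP; split; first by apply: contraNneq nv => ->.
apply/negP => hz; apply: (av x y z); last by rewrite hz lt.
by rewrite /= !eqxx sub1seq.
Qed.

(** The first entry becomes the first root: the smaller entries fill the interval below it and give
    its subtrees, the larger ones give the trees that follow. *)
Lemma av231_word_exists w m n : perm_eq w (iota m n) -> av231 w -> exists F, w = word F m.
Proof.
have [k] := ubnP (size w); elim: k w m n => // k IH [|x v] m n hk p av; first by exists [::].
have uw : uniq (x :: v) by rewrite (perm_uniq p) iota_uniq.
have xv : x \notin v by case/andP: uw.
have e := av231_partition xv av.
set A := [seq y <- v | y < x] in e; set B := [seq y <- v | x < y] in e.
have hA y : y \in A -> y < x by rewrite mem_filter => /andP[].
have hB y : y \in B -> x < y by rewrite mem_filter => /andP[].
have p1 : perm_eq (A ++ (x :: B)) (iota m n).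
  by apply: perm_trans p; rewrite e -cat1s perm_catCA.
have [|pA pxB] := perm_cat_iota p1.
  by move=> a b /hA ha; rewrite in_cons => /orP[/eqP->|/hB/ltnW]; [apply: ltnW|apply: leq_trans (ltnW ha)].
have := pxB; rewrite -cat1s => /perm_cat_iota[].
  by move=> a b; rewrite inE => /eqP-> /hB/ltnW.
move=> px pB.
have ex : x = m + size A.
  have : x \in iota (m + size A) (size [:: x]) by rewrite -(perm_mem px) mem_head.
  by rewrite /= inE => /eqP.
have szv : size A + size B = size v by rewrite -size_cat -e.
have avs u : subseq u v -> av231 u.
  move=> su a b c s; apply: av; apply: (subseq_trans s).
  by apply: (subseq_trans su); apply: subseq_cons.
have hkv : size v < k by [].
have [||F eF] := IH A m (size A) _ pA; first by rewrite (leq_ltn_trans _ hkv) // -szv leq_addr.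
  by apply: avs; apply: filter_subseq.
have [||G eG] := IH B _ _ _ pB; first by rewrite (leq_ltn_trans _ hkv) // -szv leq_addl.
  by apply: avs; apply: filter_subseq.
exists (Node F :: G); rewrite word_cons e -eF ex {1 2}eF size_word.
by rewrite eG eF size_word addn1.
Qed.

Lemma word_split_cons F G m s : subseq s (word (Node F :: G) m) ->
  exists s1 s2, [/\ s = s1 ++ s2 \/ s = m + nodes F :: s1 ++ s2,
    subseq s1 (word F m), subseq s2 (word G (m + nodes F).+1),
    (forall x, x \in s1 -> x < m + nodes F) &
    (forall x, x \in s2 -> m + nodes F < x)].
Proof.
rewrite word_cons -cat1s => /subseq_cat_split[s0 [s' [-> sub0]]].
case/subseq_cat_split => s1 [s2 [-> sub1 sub2]]; exists s1, s2; split=> //.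
- case: s0 sub0 => [|x s0]; [by left|rewrite /=].
  by case: (x =P _) => [-> /eqP->|_ //]; right.
- by move=> x /(mem_subseq sub1); rewrite mem_word => /andP[].
- by move=> x /(mem_subseq sub2); rewrite mem_word => /andP[].
Qed.

Lemma subseq_word_sub F G m : subseq (word F m) (word (Node F :: G) m).
Proof. by rewrite word_cons; apply: subseq_trans (subseq_cons _ _); apply: prefix_subseq. Qed.

Lemma subseq_word_rest F G m :
  subseq (word G (m + nodes F).+1) (word (Node F :: G) m).
Proof. by rewrite word_cons; apply: subseq_trans (subseq_cons _ _); apply: suffix_subseq. Qed.

Lemma av231_word F m : av231 (word F m).
Proof.
elim/forest_rect: F m => [|F G IHF IHG] m x y z //.
case/word_split_cons => s1 [s2 [[] e sub1 sub2 h1 h2]] /andP[lt1 lt2].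
  case: s1 e sub1 h1 => [|a [|b [|c [|d s1]]]] //= e sub1 h1.
  - by subst; apply: (IHG (m + nodes F).+1 x y z) => //; apply/andP.
  - case: e => ? e; subst; have := h1 a (mem_head _ _); have := h2 z; rewrite !inE eqxx orbT.
    by move=> /(_ isT); lia.
  - case: e => ? ? e; subst; have := h1 a (mem_head _ _); have := h2 z (mem_head _ _); lia.
  - by case: e => ? ? ? e; subst; apply: (IHF m a b c) => //; apply/andP.
case: e => ? e; subst; case: s1 e sub1 h1 => [|a s1] /= e sub1 h1.
  by have := h2 z; rewrite -e !inE eqxx orbT => /(_ isT); lia.
by case: e => ? e; subst; have := h1 a (mem_head _ _); lia.
Qed.

(** * Patterns 12, 312 and 1423 on forests *)

Definition chain : seq tree -> bool :=
  @forest_rect (fun=> bool) true (fun _ G cF _ => cF && nilp G).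

Definition chains : seq tree -> bool :=
  @forest_rect (fun=> bool) true (fun F _ _ cG => chain F && cG).

Definition forest_av1423 : seq tree -> bool :=
  @forest_rect (fun=> bool) true (fun _ G aF _ => aF && chains G).

Lemma av_sub s s' : subseq s s' ->
  [/\ av12 s' -> av12 s, av312 s' -> av312 s & av1423 s' -> av1423 s].
Proof.
move=> ss; split=> h.
- by move=> x y s0; apply: h; apply: subseq_trans ss.
- by move=> x y z s0; apply: h; apply: subseq_trans ss.
- by move=> x y z t s0; apply: h; apply: subseq_trans ss.
Qed.

(** A root exceeds its descendants, and a second root would exceed the first, so a decreasing
    reading means at most one path. *)
Lemma av12P F m : reflect (av12 (word F m)) (chain F).
Proof.
elim/forest_rect: F m => [|F G IHF IHG] m; first by left.
apply: (iffP andP) => [[/(IHF m) aF /nilP->] x y|a].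
  case/word_split_cons => s1 [[|? ?] [[] e sub1 sub2 h1 h2]] lt //.
    by rewrite cats0 in e; subst; apply: (aF x y).
  rewrite cats0 in e; case: e => ? e; subst.
  by have := h1 y (mem_head _ _); lia.
split; first by apply/(IHF m); have [+ _ _] := av_sub (subseq_word_sub F G m); apply.
case: G a {IHG} => // -[H] G a; exfalso; apply: (a (m + nodes F) ((m + nodes F).+1 + nodes H)); last lia.
by rewrite word_cons /= eqxx sub1seq mem_cat word_cons mem_head orbT.
Qed.

(** A 312 headed by the first root needs a 12 in [F]; any other lies within [F] or within [G], since
    [F] precedes [G] both in position and in value. *)
Lemma av312P F m : reflect (av312 (word F m)) (chains F).
Proof.
elim/forest_rect: F m => [|F G _ IHG] m; first by left.
apply: (iffP andP) => [[/(@av12P _ m) aF /(IHG (m + nodes F).+1) aG] x y z|a].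
  case/word_split_cons => s1 [s2 [[] e sub1 sub2 h1 h2]] /andP[lt1 lt2].
    case: s1 e sub1 h1 => [|a [|b [|c [|d s1]]]] //= e sub1 h1.
    - by subst; apply: (aG x y z) => //; apply/andP.
    - case: e => ? e; subst; have := h1 a (mem_head _ _); have := h2 z; rewrite !inE eqxx orbT.
      by move=> /(_ isT); lia.
    - case: e => ? ? e; subst; have := h1 a (mem_head _ _); have := h2 z (mem_head _ _); lia.
    - case: e => ? ? ? e; subst; apply: (aF b c) => //.
      by apply: subseq_trans sub1; apply: subseq_cons.
  case: e => ? e; subst; case: s1 e sub1 h1 => [|a [|b [|c s1]]] //= e sub1 h1.
  - by have := h2 z; rewrite -e !inE eqxx orbT => /(_ isT); lia.
  - by case: e => ? e; subst; have := h2 z (mem_head _ _); lia.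
  - by case: e => ? ? e; subst; apply: (aF a b).
split; last first.
  by apply/IHG; have [_ + _] := av_sub (subseq_word_rest F G m); apply.
apply/(@av12P F m) => x y s lt; apply: (a (m + nodes F) x y).
  rewrite word_cons [subseq _ _]/= eqxx; apply: subseq_trans s _; exact: prefix_subseq.
have : y \in word F m by apply: (mem_subseq s); rewrite !inE eqxx orbT.
by rewrite mem_word lt => /andP[].
Qed.

(** The first root plays the 1 for any 312 in [G]. Conversely, a 1423 not inside [F] has its 4,
    hence its 2 and 3, in [G]: a 4 in [F] would keep the smaller entries in [F], and nothing
    precedes the first root. *)
Lemma av1423P F m : reflect (av1423 (word F m)) (forest_av1423 F).
Proof.
elim/forest_rect: F m => [|F G IHF _] m; first by left.
apply: (iffP andP) => [[/(IHF m) aF /(@av312P G (m + nodes F).+1) aG] x y z t|a].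
  case/word_split_cons => s1 [s2 [[] e sub1 sub2 h1 h2]] /andP[lt1 lt2] lt3.
    case: s1 e sub1 h1 => [|a [|b [|c [|d [|? s1]]]]] //= e sub1 h1.
    - subst; apply: (aG y z t) => //; last by apply/andP.
      by apply: subseq_trans sub2; apply: subseq_cons.
    - by case: e => ? e; subst; apply: (aG y z t) => //; apply/andP.
    - case: e => ? ? e; subst; have := h1 b; rewrite !inE eqxx orbT => /(_ isT).
      by have := h2 z (mem_head _ _); lia.
    - case: e => ? ? ? e; subst; have := h1 b; rewrite !inE eqxx orbT => /(_ isT).
      by have := h2 t (mem_head _ _); lia.
    - case: e => ? ? ? ? e; subst; apply: (aF a b c d) => //; exact/andP.
  case: e => ? e; subst; case: s1 e sub1 h1 => [|a [|b [|c [|d s1]]]] //= e sub1 h1.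
  - by subst; apply: (aG y z t) => //; apply/andP.
  - by case: e => ? e; subst; have := h1 a (mem_head _ _); lia.
  - by case: e => ? ? e; subst; have := h1 b; rewrite !inE eqxx orbT => /(_ isT); lia.
  - by case: e => ? ? ? e; subst; have := h1 b; rewrite !inE eqxx orbT => /(_ isT); lia.
split; first by apply/(IHF m); have [_ _ +] := av_sub (subseq_word_sub F G m); apply.
apply/(@av312P G (m + nodes F).+1) => x y z s /andP[lt1 lt2].
have hy : m + nodes F < y.
  have : y \in word G (m + nodes F).+1 by apply: (mem_subseq s); rewrite !inE eqxx orbT.
  by rewrite mem_word => /andP[].
apply: (a (m + nodes F) x y z) => //; last exact/andP.
rewrite word_cons [subseq _ _]/= eqxx; apply: subseq_trans s _; exact: suffix_subseq.
Qed.

Lemma head_in (s : seq nat) : s <> [::] -> head 0 s \in s.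
Proof. by case: s => // x s _; rewrite mem_head. Qed.

Lemma last_in (s : seq nat) : s <> [::] -> last 0 s \in s.
Proof. by case: s => // x s _; rewrite /= mem_last. Qed.

(** * Tight words read on forests *)

Lemma tight_map f w : tight_word w ->
  {in w &, {homo f : x y / x < y}} -> tight_word (map f w).
Proof.
elim=> [n|A B n h tA IHA tB IHB d] hf; first exact: tight_word_one.
have inA x : x \in A -> x \in rcons (A ++ B) n by rewrite mem_rcons in_cons mem_cat => ->; rewrite orbT.
have inB x : x \in B -> x \in rcons (A ++ B) n by rewrite mem_rcons in_cons mem_cat => ->; rewrite !orbT.
have inn : n \in rcons (A ++ B) n by rewrite mem_rcons mem_head.
have nA := tight_word_neq0 tA; have nB := tight_word_neq0 tB.
rewrite map_rcons map_cat; apply: tight_word_node.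
- rewrite -map_cat all_map; apply/allP => x xAB /=; apply: hf => //.
    by rewrite mem_rcons in_cons xAB orbT.
  exact: (allP h).
- by apply: IHA => x y /inA hx /inA hy; apply: hf.
- by apply: IHB => x y /inB hx /inB hy; apply: hf.
have -> : head 0 (map f B) = f (head 0 B) by case: (B) nB.
have -> : last 0 (map f A) = f (last 0 A) by case: (A) nA => // x s _; rewrite /= last_map.
by apply: hf => //; [apply/inB/head_in|apply/inA/last_in].
Qed.

(** This lets the final leaf of [rcons A leaf] take the label of the root of [Node T], and
    conversely. *)
Lemma tight_rcons w a a' : tight_word (rcons w a) -> all (fun x => x < a') w ->
  tight_word (rcons w a').
Proof.
move E: (rcons w a) => v tv; case: tv E => [n|A B n h tA tB d] E hw.
  by case: w E hw => [|x [|y w]] // _ _; apply: tight_word_one.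
by have [ew _] := rcons_inj E; rewrite ew in hw *; apply: tight_word_node.
Qed.

(** The inequalities keep the labels of [T] below those of [B], so the gap between the two blocks
    does not affect the relative order. *)
Lemma tight_shift T B m1 m2 m1' m2' : m1 + nodes T <= m2 -> m1' + nodes T <= m2' ->
  tight_word (word T m1 ++ word B m2) -> tight_word (word T m1' ++ word B m2').
Proof.
move=> h h' t.
pose f x := if x < m1 + nodes T then x - m1 + m1' else x - m2 + m2'.
have := @tight_map f _ t; rewrite map_cat.
have -> : map f (word T m1) = word T m1'.
  rewrite -[m1]addn0 -[m1']addn0 !word_map -map_comp; apply/eq_in_map => x.
  by rewrite mem_word /f => /andP[_ hx] /=; case: ifP; lia.
have -> : map f (word B m2) = word B m2'.
  rewrite -[m2]addn0 -[m2']addn0 !word_map -map_comp; apply/eq_in_map => x.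
  by rewrite mem_word /f => /andP[_ hx] /=; case: ifP; lia.
apply=> x y; rewrite !mem_cat !mem_word /f.
by case: ifP => h1; case: ifP => h2; lia.
Qed.

Notation leaf := (Node [::]).

Lemma word_leaf m : word [:: leaf] m = [:: m].
Proof. by rewrite word_cons addn0. Qed.

Lemma nodes_rcons_leaf F : nodes (rcons F leaf) = (nodes F).+1.
Proof. by rewrite -cats1 nodes_cat nodes_cons addn1. Qed.

Lemma word_rcons_leaf F m : word (rcons F leaf) m = rcons (word F m) (m + nodes F).
Proof. by rewrite -cats1 word_cat word_leaf cats1. Qed.

Lemma nodes_glue A T B :
  nodes (A ++ Node T :: rcons B leaf) = (nodes A + nodes (T ++ B)).+2.
Proof. by rewrite nodes_cat nodes_cons nodes_rcons_leaf nodes_cat; lia. Qed.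

Lemma word_glue A T B m :
  word (A ++ Node T :: rcons B leaf) m =
  rcons (rcons (word A m) (m + nodes A + nodes T) ++
         (word T (m + nodes A) ++ word B (m + nodes A + nodes T).+1))
        ((m + nodes A + nodes T).+1 + nodes B).
Proof.
by rewrite word_cat word_cons word_rcons_leaf -!cats1 -!catA.
Qed.

Lemma nodes_eq0 F : nodes F = 0 -> F = [::].
Proof. by case: F => [|[F] G]. Qed.

Lemma word_eq0 F m : word F m = [::] -> F = [::].
Proof. by move=> e; apply: nodes_eq0; rewrite -(size_word F m) e. Qed.

(** [X] reads [rcons A leaf] with its last label raised to [a], and [Y] reads [T ++ B] with a gap
    opened for [a]. As [T] is nonempty, [Y] starts inside [T], below its root label [a]: this is the
    descent. *)
Lemma tight_glue_parts A T B m (a := m + nodes A + nodes T)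
  (X := rcons (word A m) a)
  (Y := word T (m + nodes A) ++ word B a.+1) : T <> [::] ->
  tight_word (word (rcons A leaf) m) -> tight_word (word (T ++ B) m) ->
  [/\ tight_word X, tight_word Y, head 0 Y < last 0 X &
      all (fun x => x < a.+1 + nodes B) (X ++ Y)].
Proof.
move=> T0; rewrite word_rcons_leaf word_cat => tA tB; split.
- apply: (tight_rcons tA); apply/allP => x; rewrite mem_word /a; lia.
- by apply: tight_shift tB.
- rewrite last_rcons /Y; have : word T (m + nodes A) <> [::] by move/word_eq0.
  case E: (word T _) => [|x s] // _.
  have : x \in word T (m + nodes A) by rewrite E mem_head.
  by rewrite mem_word => /andP[].
- apply/allP => x; rewrite !mem_cat mem_rcons in_cons !mem_word /a.
  by case/or3P => [/orP[/eqP->|]||]; lia.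
Qed.

Lemma tight_glue A T B m : T <> [::] ->
  tight_word (word (rcons A leaf) m) -> tight_word (word (T ++ B) m) ->
  tight_word (word (A ++ Node T :: rcons B leaf) m).
Proof.
by move=> T0 tA tB; rewrite word_glue; have [tX tY d h] := tight_glue_parts T0 tA tB; apply: tight_word_node.
Qed.

(** Uniqueness of the tight splitting recovers the first half, hence [A]; the rest follows by
    cancellation. *)
Lemma glue_inj A T B A' T' B' m : T <> [::] -> T' <> [::] ->
  tight_word (word (rcons A leaf) m) -> tight_word (word (T ++ B) m) ->
  tight_word (word (rcons A' leaf) m) -> tight_word (word (T' ++ B') m) ->
  A ++ Node T :: rcons B leaf = A' ++ Node T' :: rcons B' leaf ->
  [/\ A = A', T = T' & B = B'].
Proof.
move=> T0 T0' tA tB tA' tB' e.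
have [tX tY d _] := tight_glue_parts T0 tA tB.
have [/tight_sorted sX' /tight_sorted sY' _ _] := tight_glue_parts T0' tA' tB'.
have := congr1 (word^~ m) e; rewrite /= !word_glue => /rcons_inj[eXY _].
have [/rcons_inj[/word_inj eA _] _] := tight_split_unique tX tY d sX' sY' eXY.
by move: e; rewrite eA => /cat_injl[-> /rcons_inj[->]].
Qed.

(* A left-to-right maximum of a preorder reading of postorder labels has no
   ancestor, hence is the label of a root. *)
Lemma word_root G m X a Y : word G m = X ++ a :: Y -> all (fun x => x < a) X ->
  exists A T B, [/\ G = A ++ Node T :: B, X = word A m, a = m + nodes A + nodes T &
    Y = word T (m + nodes A) ++ word B a.+1].
Proof.
elim/forest_rect: G m X => [|T G _ IH] m [|x X] //.
  by rewrite word_cons => -[<- <-] _; exists [::], T, G; rewrite addn0.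
rewrite word_cons => -[ex e] /= /andP[lt hX]; subst x.
have lX : size (word T m) <= size X.
  rewrite leqNgt; apply/negP => lX.
  have [E [eT eY]] := cat_eq_split (esym e) (ltnW lX).
  case: E eT eY => [|b E] eT eY; first by move: lX; rewrite eT cats0 ltnn.
  case: eY => eab _; subst b.
  have : a \in word T m by rewrite eT mem_cat mem_head orbT.
  by rewrite mem_word; lia.
have [X' [eX eG]] := cat_eq_split e lX.
have [|A [T' [B [-> eX' ea eY]]]] := IH _ _ eG.
  by move: hX; rewrite eX all_cat => /andP[].
exists (Node T :: A), T', B; rewrite nodes_cons; split=> //.
- by rewrite eX eX' word_cons.
- by rewrite ea; lia.
- by rewrite eY; congr (word T' _ ++ _); lia.
Qed.

Lemma tight_last w x : tight_word w -> x \in w -> x <= last 0 w.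
Proof. by move/tight_sorted/sorted_le_last; apply. Qed.

(** In a tight word [X Y n] the last entry of [X] is a left-to-right maximum, hence the label of a
    root by [word_root]; this root is [Node T]. *)
Lemma tight_unglue F m : tight_word (word F m) ->
  F = [:: leaf] \/ exists A T B, [/\ F = A ++ Node T :: rcons B leaf, T <> [::],
    tight_word (word (rcons A leaf) m) & tight_word (word (T ++ B) m)].
Proof.
case/lastP: F => [/tight_word_neq0//|F [H]] tw.
(* If [H] were nonempty, the root of the last tree would exceed the last entry, which lies in [H],
   although the last entry of a tight word is its largest. *)
have eH : H = [::].
  apply/(@word_eq0 _ (m + nodes F))/eqP; case: eqVneq => // /eqP nH; exfalso.
  have := @tight_last _ (m + nodes F + nodes H) tw.
  rewrite -cats1 word_cat word_cons cats0 mem_cat mem_head orbT last_cat /= => /(_ isT).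
  have : last (m + nodes F + nodes H) (word H (m + nodes F)) \in word H (m + nodes F).
    by case: (word H _) nH => // x s _; rewrite /= mem_last.
  by rewrite mem_word; lia.
subst H; rewrite word_rcons_leaf in tw.
move E: (rcons _ _) tw => w tw; case: tw E => [n|X Y n h tX tY d] E.
  left; have /word_eq0-> // : word F m = [::].
  by case: (word F m) E => // x [|].
right; have [eF en] := rcons_inj E.
case/lastP: X tX d h eF E => [/tight_word_neq0//|X a] tX d h eF E.
rewrite last_rcons in d; rewrite cat_rcons in eF.
have hX : all (fun x => x < a) X.
  apply/allP => x xX; rewrite ltn_neqAle; apply/andP; split.
    apply/eqP => xa; have := uniq_word F m; rewrite eF -xa cat_uniq /= => /and3P[_ /norP[/negP]] //.
  by have := @tight_last _ x tX; rewrite last_rcons mem_rcons in_cons xX orbT; apply.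
have [A [T [B [eF' eX ea eY]]]] := word_root eF hX.
(* With [T] empty, [Y] would begin in [B] with a label above [a], and there would be no descent. *)
have T0 : T <> [::].
  move=> T0; have : head 0 Y \in word B a.+1.
    by have := head_in (tight_word_neq0 tY); rewrite [X in _ \in X]eY T0.
  by rewrite mem_word; lia.
exists A, T, B; split=> //.
- by rewrite eF' rcons_cat rcons_cons.
- rewrite word_rcons_leaf -eX; apply: (tight_rcons tX); rewrite eX.
  by apply/allP => x; rewrite mem_word => /andP[].
- rewrite word_cat; apply: (@tight_shift T B (m + nodes A) a.+1) => //.
    by rewrite ea.
  by rewrite -eY.
Qed.

Lemma tight_rcons_leaf F m : tight_word (word F m) -> exists A, F = rcons A leaf.
Proof.
case/tight_unglue => [->|[A [T [B [-> _ _ _]]]]]; first by exists [::].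
by exists (A ++ Node T :: B); rewrite -rcons_cons rcons_cat.
Qed.

Lemma tight_nodes F m : tight_word (word F m) -> exists d, nodes F = d.*2.+1.
Proof. by move/tight_word_des; rewrite size_word; exists (des (word F m)). Qed.

(** * Pattern conditions on glued forests *)

Lemma chain_cons F G : chain (Node F :: G) = chain F && nilp G.
Proof. by []. Qed.

Lemma chains_cons F G : chains (Node F :: G) = chain F && chains G.
Proof. by []. Qed.

Lemma forest_av1423_cons F G :
  forest_av1423 (Node F :: G) = forest_av1423 F && chains G.
Proof. by []. Qed.

Arguments chain : simpl never.
Arguments chains : simpl never.
Arguments forest_av1423 : simpl never.

Lemma chains_cat F G : chains (F ++ G) = chains F && chains G.
Proof. by elim: F => // -[H] F IH; rewrite cat_cons !chains_cons IH andbA. Qed.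

Lemma chains_rcons_leaf F : chains (rcons F leaf) = chains F.
Proof. by rewrite -cats1 chains_cat andbT. Qed.

Lemma chain_size1 T : T <> [::] -> chain T = (size T == 1) && chains T.
Proof. by case: T => [|[H] [|t T]] // _; rewrite chain_cons ?andbF // chains_cons. Qed.

Lemma chains_glue A T B : T <> [::] ->
  chains (A ++ Node T :: rcons B leaf) =
  [&& chains (rcons A leaf), size T == 1 & chains (T ++ B)].
Proof.
move=> T0; rewrite chains_cat chains_cons !chains_rcons_leaf chain_size1 // chains_cat.
by rewrite -!andbA.
Qed.

Lemma av1423_glue0 T B : T <> [::] ->
  forest_av1423 (Node T :: rcons B leaf) = forest_av1423 (T ++ B).
Proof.
case: T => // -[H] T _.
by rewrite cat_cons !forest_av1423_cons chains_rcons_leaf chains_cat andbA.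
Qed.

(** When [A] is nonempty, [Node T] is not the first tree and must be a path; when [A] is empty it is
    the first tree, and [T] may consist of several trees. *)
Lemma av1423_glue A T B : A <> [::] -> T <> [::] ->
  forest_av1423 (A ++ Node T :: rcons B leaf) =
  [&& forest_av1423 (rcons A leaf), size T == 1 & chains (T ++ B)].
Proof.
case: A => // -[H] A _ T0.
by rewrite rcons_cons cat_cons !forest_av1423_cons chains_glue // andbA.
Qed.

(** * Enumeration of the forests *)

(** Course-of-values recursion: [step f k] is the value at [k.+1], computed from [f] up to [k]. [x0]
    is both the value at 0 and the default of [nth]. *)
Fixpoint cov_table (T : Type) (x0 : T) (step : (nat -> T) -> nat -> T) (k : nat) :
    seq T :=
  if k is k'.+1 then
    let s := cov_table x0 step k' in rcons s (step (nth x0 s) k')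
  else [:: x0].

Definition cov (T : Type) (x0 : T) (step : (nat -> T) -> nat -> T) (k : nat) : T :=
  nth x0 (cov_table x0 step k) k.

Lemma size_cov_table (T : Type) (x0 : T) step k : size (cov_table x0 step k) = k.+1.
Proof. by elim: k => //= k IH; rewrite size_rcons IH. Qed.

Lemma nth_cov_table (T : Type) (x0 : T) step i k : i <= k ->
  nth x0 (cov_table x0 step k) i = cov x0 step i.
Proof.
elim: k => [|k IH]; first by rewrite leqn0 => /eqP->.
rewrite leq_eqVlt => /orP[/eqP->//|lt].
by rewrite /= nth_rcons size_cov_table lt IH.
Qed.

Lemma covS (T : Type) (x0 : T) (step : (nat -> T) -> nat -> T) k :
  (forall f g, (forall i, i <= k -> f i = g i) -> step f k = step g k) ->
  cov x0 step k.+1 = step (cov x0 step) k.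
Proof.
move=> ext; rewrite /cov /= nth_rcons size_cov_table ltnn eqxx.
by apply: ext => i hi; apply: nth_cov_table.
Qed.

(** [A] comes with its final leaf, which is removed; [B] is the joint list of both remaining parts,
    cut after [b] trees. *)
Definition glue (A : seq tree) (b : nat) (B : seq tree) : seq tree :=
  take (size A).-1 A ++ Node (take b B) :: rcons (drop b B) leaf.

Lemma glue_rcons A t b B :
  glue (rcons A t) b B = A ++ Node (take b B) :: rcons (drop b B) leaf.
Proof. by rewrite /glue size_rcons -cats1 take_size_cat. Qed.

Definition glue_conv (U V : nat -> seq (seq tree)) (k : nat) : seq (seq tree) :=
  [seq glue AB.1 1 AB.2 | i <- iota 0 k.+1,
                          AB <- [seq (A, B) | A <- U i, B <- V (k - i)]].

Lemma glue_conv_ext U V U' V' k : (forall i, i <= k -> U i = U' i) ->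
  (forall i, i <= k -> V i = V' i) -> glue_conv U V k = glue_conv U' V' k.
Proof.
move=> eU eV; rewrite /glue_conv; congr flatten; apply/eq_in_map => i.
by rewrite mem_iota => /andP[_ hi]; rewrite eU // eV // leq_subr.
Qed.

Definition layered_forests : nat -> seq (seq tree) :=
  cov [:: [:: leaf]] (fun V k => glue_conv V V k).

(** Index [k] means [2k + 3] nodes, against [2k + 1] for [layered_forests]. Leaving out the single
    leaf makes [A] nonempty in [glue_conv]; empty [A] is the first list, with every possible cut. *)
Definition good_forests : nat -> seq (seq tree) :=
  cov [:: [:: Node [:: leaf]; leaf]]
    (fun U k => [seq glue [:: leaf] b B | B <- U k, b <- iota 1 (size B)] ++
                glue_conv U layered_forests k).

Lemma layered_forestsS k :
  layered_forests k.+1 = glue_conv layered_forests layered_forests k.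
Proof. by apply: covS => f g e; apply: glue_conv_ext. Qed.

Lemma good_forestsS k : good_forests k.+1 =
  [seq glue [:: leaf] b B | B <- good_forests k, b <- iota 1 (size B)] ++
  glue_conv good_forests layered_forests k.
Proof. by apply: covS => f g e; rewrite e //; congr (_ ++ _); apply: glue_conv_ext. Qed.

Lemma mem_glue_conv U V k F :
  (forall i A, i <= k -> A \in U i -> exists A', A = rcons A' leaf) ->
  F \in glue_conv U V k <-> exists i A B, [/\ i <= k, rcons A leaf \in U i,
    B \in V (k - i) & F = A ++ Node (take 1 B) :: rcons (drop 1 B) leaf].
Proof.
move=> hU; split.
  case/allpairsPdep => i [[A0 B]] []; rewrite mem_iota add0n ltnS => /andP[_ hi].
  case/allpairsPdep => A1 [B1 [hA hB [? ?]]]; subst A1 B1 => -> /=.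
  have [A eA] := hU _ _ hi hA; subst A0; exists i, A, B; split=> //.
  by rewrite glue_rcons.
case=> i [A [B [hi hA hB ->]]]; apply/allpairsPdep; exists i, (rcons A leaf, B).
by rewrite mem_iota add0n ltnS hi glue_rcons allpairs_f.
Qed.

Lemma nodes_eq1 F : nodes F = 1 -> F = [:: leaf].
Proof.
case: F => // -[H] G; rewrite nodes_cons => -[] e.
by rewrite (@nodes_eq0 H) 1?(@nodes_eq0 G) //; lia.
Qed.

Lemma tight_leaf m : tight_word (word [:: leaf] m).
Proof. by rewrite word_leaf; apply: tight_word_one. Qed.

Lemma neq0_take1 (F : seq tree) : F <> [::] -> take 1 F <> [::] /\ size (take 1 F) = 1.
Proof. by case: F => // t F _; rewrite /= take0. Qed.

Lemma take1_cat (T B : seq tree) : size T = 1 -> take 1 (T ++ B) = T /\ drop 1 (T ++ B) = B.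
Proof. by move=> e; rewrite -e take_size_cat // drop_size_cat. Qed.

Lemma tight_forest_neq0 F m : tight_word (word F m) -> F <> [::].
Proof. by move=> t F0; move: t; rewrite F0 => /tight_word_neq0. Qed.

Lemma mem_layered_forests k F : F \in layered_forests k <->
  [/\ tight_word (word F 1), chains F & nodes F = k.*2.+1].
Proof.
elim/ltn_ind: k F => -[|k] IH F.
  split; first by rewrite inE => /eqP->; split=> //; apply: tight_leaf.
  by case=> _ _ /nodes_eq1->; rewrite inE.
rewrite layered_forestsS mem_glue_conv; last first.
  by move=> i A hi /(IH i hi)[/tight_rcons_leaf].
split.
  case=> i [A [B [hi /(IH i hi)[tA cA nA] /IH[|tB cB nB ->]]]]; first by rewrite ltnS leq_subr.
  have [T0 s1] := neq0_take1 (tight_forest_neq0 tB); split.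
  - by apply: tight_glue => //; rewrite cat_take_drop.
  - by rewrite chains_glue // cA s1 cat_take_drop.
  - by rewrite nodes_glue cat_take_drop nB; move: nA; rewrite nodes_rcons_leaf; lia.
case=> /tight_unglue[->|[A [T [B [-> T0 tA tB]]]]] //.
rewrite chains_glue // => /and3P[cA /eqP s1 cB] nF.
have [d nA] := tight_nodes tA; have [e nB] := tight_nodes tB.
move: nF; rewrite nodes_glue nB; move: (nA); rewrite nodes_rcons_leaf => nA' nF.
have hd : d <= k by lia.
have [e1 e2] := take1_cat B s1.
exists d, A, (T ++ B); rewrite e1 e2; split=> //; first by apply/IH.
by apply/IH; [lia|split=> //; rewrite nB; lia].
Qed.

Lemma mem_good_forests k F : F \in good_forests k <->
  [/\ tight_word (word F 1), forest_av1423 F & nodes F = k.*2.+3].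
Proof.
elim/ltn_ind: k F => -[|k] IH F.
  split; first rewrite inE => /eqP->.
    by split=> //; apply: (@tight_glue [::] [:: leaf] [::]) => //; apply: tight_leaf.
  case=> /tight_unglue[->|[A [T [B [-> T0 tA tB]]]]] // _.
  have [e nB] := tight_nodes tB.
  rewrite nodes_glue nB => nF; have /nodes_eq0-> : nodes A = 0 by lia.
  have {nF}/nodes_eq1 : nodes (T ++ B) = 1 by lia.
  by case: T T0 {tB nB} => // t [|u T] // _ [-> ->]; rewrite inE.
rewrite good_forestsS mem_cat; split; [case/orP|].
- case/allpairsPdep => B [b [/(IH k (ltnSn k))[tB aB nB]]].
  rewrite mem_iota => /andP[b0 hb] ->; rewrite (glue_rcons [::]) cat0s.
  have T0 : take b B <> [::].
    by move/(congr1 size); rewrite size_take_min /=; move: hb; lia.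
  split.
  + apply: (@tight_glue [::]) => //; first exact: tight_leaf.
    by rewrite cat_take_drop.
  + by rewrite av1423_glue0 // cat_take_drop.
  + by rewrite (nodes_glue [::]) cat_take_drop nB.
- rewrite mem_glue_conv; last by move=> i A hi /(IH i hi)[/tight_rcons_leaf].
  case=> i [A [B [hi /(IH i hi)[tA aA nA] /mem_layered_forests[tB cB nB ->]]]].
  have [T0 s1] := neq0_take1 (tight_forest_neq0 tB).
  have A0 : A <> [::] by move=> A0; move: nA; rewrite A0.
  split.
  + by apply: tight_glue => //; rewrite cat_take_drop.
  + by rewrite av1423_glue // aA s1 cat_take_drop.
  + by rewrite nodes_glue cat_take_drop nB; move: nA; rewrite nodes_rcons_leaf; lia.
case=> /tight_unglue[->|[A [T [B [-> T0 tA tB]]]]] // aF nF; apply/orP.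
have [d nA] := tight_nodes tA; have [e nB] := tight_nodes tB.
move: nF; rewrite nodes_glue nB; move: (nA); rewrite nodes_rcons_leaf => nA' nF.
case: (eqVneq A [::]) => [A0|/eqP A0].
  subst A; left; apply/allpairsPdep; exists (T ++ B), (size T).
  rewrite (glue_rcons [::]) take_size_cat // drop_size_cat //; split=> //.
    apply/IH => //; split=> //; first by rewrite -av1423_glue0.
    by rewrite nB; move: nA' nF => /=; rewrite /nodes /=; lia.
  rewrite mem_iota size_cat add1n ltnS leq_addr andbT.
  by case: (T) T0.
move: aF; rewrite av1423_glue // => /and3P[aA /eqP s1 cB].
have [e1 e2] := take1_cat B s1.
have nA0 : nodes A <> 0 by move/nodes_eq0.
right; rewrite mem_glue_conv; last by move=> i A' hi /(IH i hi)[/tight_rcons_leaf].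
(* [rcons A leaf] has [2d + 1] nodes, hence index [d - 1] in [good_forests], which starts at three
   nodes. *)
exists d.-1, A, (T ++ B); rewrite e1 e2; split=> //; first by lia.
  by apply/IH; [lia|split=> //; rewrite nA; lia].
by apply/mem_layered_forests; split=> //; rewrite nB; lia.
Qed.

Lemma take1_drop1_inj (B B' : seq tree) :
  take 1 B = take 1 B' -> drop 1 B = drop 1 B' -> B = B'.
Proof. by move=> e1 e2; rewrite -(cat_take_drop 1 B) e1 e2 cat_take_drop. Qed.

(** [glue_inj] recovers both factors from the glued forest, and the disjointness of the lists [U i]
    recovers [i]. *)
Lemma uniq_glue_conv U V k :
  (forall i, i <= k -> uniq (U i)) -> (forall i, i <= k -> uniq (V i)) ->
  (forall i j A, A \in U i -> A \in U j -> i = j) ->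
  (forall i A, A \in U i -> tight_word (word A 1)) ->
  (forall i B, B \in V i -> tight_word (word B 1)) ->
  uniq (glue_conv U V k).
Proof.
move=> uU uV dU tU tV; apply: allpairs_uniq_dep; first exact: iota_uniq.
  move=> i; rewrite mem_iota => /andP[_ hi].
  by apply: allpairs_uniq; [exact: uU|by apply: uV; rewrite leq_subr|move=> [? ?] [? ?] _ _].
move=> p q /allpairsPdep[i [AB [_ /allpairsPdep[A [B [hA hB ->]]] ->]]].
case/allpairsPdep=> i' [AB' [_ /allpairsPdep[A' [B' [hA' hB' ->]]] ->]] /=.
have [A0 eA] := tight_rcons_leaf (tU _ _ hA).
have [A0' eA'] := tight_rcons_leaf (tU _ _ hA').
move: (tU _ _ hA) (tU _ _ hA') (tV _ _ hB) (tV _ _ hB') => tA tA' tB tB'.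
rewrite eA eA' !glue_rcons => e; rewrite eA eA' in tA tA'.
have [] := @glue_inj _ _ _ _ _ _ 1 _ _ tA _ tA' _ e; rewrite ?cat_take_drop //.
- by have [] := neq0_take1 (tight_forest_neq0 tB).
- by have [] := neq0_take1 (tight_forest_neq0 tB').
move=> e0 e1 e2; have eB := take1_drop1_inj e1 e2; subst A0' B' A A'.
by have -> := dU _ _ _ hA hA'.
Qed.

Lemma uniq_layered_forests k : uniq (layered_forests k).
Proof.
elim/ltn_ind: k => -[|k] IH //; rewrite layered_forestsS.
apply: uniq_glue_conv => // [i j A|i A|i A] /mem_layered_forests[] //.
by move=> _ _ nA /mem_layered_forests[_ _]; rewrite nA; lia.
Qed.

Lemma uniq_good_forests k : uniq (good_forests k).
Proof.
elim/ltn_ind: k => -[|k] IH //; rewrite good_forestsS cat_uniq; apply/and3P; split.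
- apply: allpairs_uniq_dep; first exact: IH.
    by move=> B _; apply: iota_uniq.
  move=> p q /allpairsPdep[B [b [/mem_good_forests[tB _ _] hb ->]]].
  case/allpairsPdep=> B' [b' [/mem_good_forests[tB' _ _] hb' ->]] /=.
  rewrite !mem_iota in hb hb'.
  rewrite !(glue_rcons [::]) => -[] e /rcons_inj[] e'.
  have eB : B = B' by rewrite -(cat_take_drop b B) e e' cat_take_drop.
  subst B'; have := congr1 size e; rewrite !size_takel; try lia.
  by move=> ->.
(* The two rules never give the same forest: the first glues with [A] empty, the second with [A]
   nonempty. *)
- apply/hasPn => F; rewrite mem_glue_conv; last first.
    by move=> i A _ /mem_good_forests[/tight_rcons_leaf].
  case=> i [A [B [_ /mem_good_forests[tA _ nA] /mem_layered_forests[tB _ _] ->]]].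
  apply/negP => /allpairsPdep[B' [b' [/mem_good_forests[tB' _ _]]]].
  rewrite mem_iota => hb'; rewrite (glue_rcons [::]) => e.
  have := @glue_inj _ _ _ [::] _ _ 1 _ _ tA _ _ _ e; rewrite !cat_take_drop.
  case=> //.
  + by have [] := neq0_take1 (tight_forest_neq0 tB).
  + by move/(congr1 size); rewrite size_takel /=; lia.
  + exact: tight_leaf.
  + by move=> A0; move: nA; rewrite A0.
- apply: uniq_glue_conv => [i hi|i hi|i j A|i A|i A].
  + exact: IH.
  + exact: uniq_layered_forests.
  + by move=> /mem_good_forests[_ _ nA] /mem_good_forests[_ _]; rewrite nA; lia.
  + by case/mem_good_forests.
  + by case/mem_layered_forests.
Qed.

(** * Numbers of trees and the succession rule *)

Lemma size_glue A T B : size (A ++ Node T :: rcons B leaf) = (size A + size B).+2.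
Proof. by rewrite size_cat /= size_rcons !addnS. Qed.

Lemma size_layered_forest k F : F \in layered_forests k -> size F = k.+1.
Proof.
elim/ltn_ind: k F => -[|k] IH F; first by rewrite inE => /eqP->.
rewrite layered_forestsS mem_glue_conv; last first.
  by move=> i A _ /mem_layered_forests[/tight_rcons_leaf].
case=> i [A [B [hi hA hB ->]]].
have := IH i hi _ hA; rewrite size_rcons => -[sA].
have sB : size B = (k - i).+1 by apply: IH hB; rewrite ltnS leq_subr.
by rewrite size_glue size_drop sA sB subSS subn0 subnKC.
Qed.

Definition layered_count (k : nat) : nat := size (layered_forests k).

(** The Catalan recurrence, starting from [layered_count 0 = 1]. *)
Lemma layered_countS k :
  layered_count k.+1 = \sum_(i < k.+1) layered_count i * layered_count (k - i).
Proof.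
rewrite {1}/layered_count layered_forestsS size_allpairs_dep sumnE big_map.
rewrite -(big_mkord xpredT (fun i => layered_count i * layered_count (k - i))).
by rewrite /index_iota subn0; apply: eq_bigr => i _; rewrite size_allpairs.
Qed.

(** The succession rule against an arbitrary weight: the cuts of a forest with [c] trees give one
    forest for each number of trees from 2 to [c + 1], and gluing with a layered forest of index [j]
    adds [j + 1] trees. *)
Lemma sum_good_forestsS k (g : nat -> nat) :
  \sum_(F <- good_forests k.+1) g (size F) =
  \sum_(F <- good_forests k) \sum_(2 <= c < (size F).+2) g c +
  \sum_(i < k.+1) \sum_(A <- good_forests i)
     layered_count (k - i) * g (size A + (k - i).+1).
Proof.
rewrite good_forestsS big_cat /=; congr (_ + _); rewrite big_allpairs_dep.
  apply: eq_bigr => B _; rewrite big_add1 big_nat_rev.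
  have -> : iota 1 (size B) = index_iota 1 (size B).+1 by rewrite /index_iota subSS subn0.
  apply: eq_big_nat => b /andP[b0 hb].
  rewrite (glue_rcons [::]) size_glue size_drop; congr g.
  by rewrite add0n add1n subSS subSn.
rewrite -(big_mkord xpredT (fun i => \sum_(A <- good_forests i)
     layered_count (k - i) * g (size A + (k - i).+1))).
rewrite /index_iota subn0; apply: eq_bigr => i _; rewrite big_allpairs.
apply: eq_big_seq => A /mem_good_forests[/tight_rcons_leaf[A' ->] _ _].
rewrite (eq_big_seq (fun=> g (size (rcons A' leaf) + (k - i).+1))).
  by rewrite big_const_seq count_predT iter_addn_0 mulnC.
move=> B /size_layered_forest sB /=; rewrite glue_rcons size_glue size_drop sB size_rcons.
by rewrite subSS subn0 addSn addnS.
Qed.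

(** * Counting *)

(* The coefficient of x^n in T^s, where T = 1 + x T^3; the recursion is
   T^s = T^(s-1) + x T^(s+2). *)
Fixpoint ternary (n s : nat) : nat :=
  if n is n'.+1 then \sum_(j < s) ternary n' (j + 3) else 1.

Lemma ternaryS0 n : ternary n.+1 0 = 0. Proof. exact: big_ord0. Qed.

Lemma ternarySS n s : ternary n.+1 s.+1 = ternary n.+1 s + ternary n (s + 3).
Proof. exact: big_ord_recr. Qed.

Lemma sum_triangle (f : nat -> nat -> nat) N :
  \sum_(m < N) \sum_(i < m.+1) f i (m - i) = \sum_(i < N) \sum_(j < N - i) f i j.
Proof.
elim: N => [|N IH]; first by rewrite !big_ord0.
under [RHS]eq_bigr => i _ do rewrite (subSn (leq_ord i)) big_ord_recr /=.
by rewrite big_split /= big_ord_recr /= IH [in RHS]big_ord_recr /= subnn big_ord0 addn0.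
Qed.

(* T^c C(xT) = T^(c+1), C the Catalan series: C(xT) satisfies the equation
   C = 1 + xT C^2, whose solution is T. *)
Lemma layered_ternary n c :
  \sum_(m < n.+1) layered_count m * ternary (n - m) (c + m) = ternary n c.+1.
Proof.
elim/ltn_ind: n c => -[|n] IH c; first by rewrite big_ord_recl big_ord0.
rewrite big_ord_recl subn0 addn0 mul1n ternarySS; congr (_ + _).
pose f i j := layered_count i * (layered_count j * ternary (n - i - j) (c + i.+1 + j)).
rewrite (eq_bigr (fun m : 'I_n.+1 => \sum_(i < m.+1) f i (m - i))); last first.
  move=> m _; rewrite lift0 layered_countS subSS big_distrl /=; apply: eq_bigr => i _.
  by rewrite /f -mulnA -subnDA -addnA addSn subnKC // leq_ord.
rewrite sum_triangle addn3 -(IH n (ltnSn n) c.+2); apply: eq_bigr => i _.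
by rewrite /f -big_distrr subSn ?leq_ord //= IH ?ltnS ?leq_subr // !addnS !addSn.
Qed.

(** The weight obeys the succession rule: a forest counts itself when [n = 0], then its children
    under the first rule, one index further, and under the second, [j + 1] further. It comes from
    T^(c+1) = T^c + x T^(c+3), with the last term expanded by [layered_ternary]. *)
Lemma ternary_branch n c : ternary n c.+1 = (n == 0) +
  \sum_(2 <= d < c.+2) (if n is n'.+1 then ternary n' d.+1 else 0) +
  \sum_(j < n) layered_count j * ternary (n - j.+1) (c + j).+2.
Proof.
case: n => [|n]; first by rewrite big1 // big_ord0.
rewrite add0n ternarySS; congr (_ + _).
  rewrite (big_addn 0 _ 2) big_mkord subSS subSS subn0.
  by apply: eq_bigr => i _; rewrite addn2 addn3.
rewrite addn3 -layered_ternary; apply: eq_bigr => j _.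
by rewrite subSS !addSn.
Qed.

(** The total weight up to index [N] is computed twice: [e1] groups it by how each forest arises,
    [e2] by what each forest produces. The common terms cancel, leaving [h N 2], the weight of the
    initial forest with two trees, against the forests of index [N], each of weight 1. *)
Lemma size_good_forests N : size (good_forests N) = ternary N.+1 1.
Proof.
pose h n c := ternary n c.+1.
pose G i j := \sum_(A <- good_forests i) layered_count j * h (N - (i + j).+1) (size A + j.+1).
have e1 : \sum_(i < N.+1) \sum_(F <- good_forests i) h (N - i) (size F) =
    h N 2 + (\sum_(i < N) \sum_(F <- good_forests i) \sum_(2 <= c < (size F).+2) h (N - i.+1) c +
             \sum_(i < N) \sum_(j < N - i) G i j).
  rewrite big_ord_recl big_seq1 subn0 -sum_triangle -big_split /=; congr (_ + _).
  apply: eq_bigr => i _; rewrite /bump add1n sum_good_forestsS; congr (_ + _).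
  by apply: eq_bigr => j _; rewrite /G subnKC // leq_ord.
have e2 : \sum_(i < N.+1) \sum_(F <- good_forests i) h (N - i) (size F) =
    size (good_forests N) +
    (\sum_(i < N) \sum_(F <- good_forests i) \sum_(2 <= c < (size F).+2) h (N - i.+1) c +
     \sum_(i < N) \sum_(j < N - i) G i j).
  rewrite big_ord_recr /= addnC subnn; congr (_ + _); first by rewrite sum1_size.
  rewrite -big_split /=; apply: eq_bigr => i _.
  rewrite /G exchange_big -big_split /=; apply: eq_bigr => F _.
  rewrite /h ternary_branch subnS; have : 0 < N - i by rewrite subn_gt0.
  case E: (N - i) => [//|n] _; rewrite add0n /=; congr (_ + _); apply: eq_bigr => j _.
  rewrite addnS subSS.
  by have -> : N - (i + j).+1 = n - j by rewrite -addnS subnDA E subSS.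
have /addIn -> := etrans (esym e2) e1.
by rewrite /h [RHS]big_ord1.
Qed.

(** The Fuss-Catalan (Raney) closed form of the coefficient of x^n in T^s, kept free of division;
    the double induction follows the recursion of [ternary]. *)
Lemma ternary_bin n s : (3 * n + s) * ternary n s = s * 'C(3 * n + s, n).
Proof.
elim: n s => [|n IHn]; first by move=> s; rewrite bin0.
elim=> [|s IHs]; first by rewrite ternaryS0 muln0.
have := IHn (s + 3); rewrite ternarySS (addnS (3 * n.+1)) binS.
have -> : 3 * n + (s + 3) = 3 * n.+1 + s by lia.
have := mul_bin_left (3 * n.+1 + s) n; have -> : 3 * n.+1 + s - n = 2 * n + s + 3 by lia.
move: IHs; move: (ternary n.+1 s) (ternary n (s + 3)) => a b.
move: 'C(3 * n.+1 + s, n.+1) 'C(3 * n.+1 + s, n) => Y X ha hX hb.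
(* This factor is the one on the left of both induction hypotheses, so that [a] and [b] can be
   eliminated. *)
apply/eqP; rewrite -(@eqn_pmul2l (3 * n.+1 + s)); last by lia.
rewrite mulnCA mulnDr ha hb; apply/eqP; lia.
Qed.

Lemma ternary1_bin k : (2 * k + 1) * ternary k 1 = 'C(3 * k, k).
Proof.
have := ternary_bin k 1; have := mul_bin_down (3 * k + 1) k.
rewrite mul1n addn1 /=; have -> : (3 * k).+1 - k = 2 * k + 1 by lia.
by move=> h e; apply/eqP; rewrite -(@eqn_pmul2l (3 * k).+1) // mulnCA e h.
Qed.

Lemma card_uniquely_sorted_avoiding n (L : seq (seq tree)) : 0 < n -> uniq L ->
  (forall F, F \in L <-> [/\ tight_word (word F 1), forest_av1423 F & nodes F = n]) ->
  #|uniquely_sorted_avoiding n [:: [:: 2; 3; 1]; [:: 1; 4; 2; 3]]| = size L.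
Proof.
move=> n0 uL hL; set S := uniquely_sorted_avoiding _ _.
rewrite cardE -(size_map (@one_line n)) -(size_map (word^~ 1) L).
apply: perm_size; apply: uniq_perm.
- by rewrite (map_inj_uniq (@one_line_inj n)) enum_uniq.
- by rewrite map_inj_uniq // => F G /word_inj.
move=> w; apply/mapP/mapP => -[].
  move=> p; rewrite mem_enum inE => /and4P[/(uniquely_sortedP _ n0) tp].
  move=> /contains231P a231 /contains1423P a1423 _ ->.
  have [F eF] := av231_word_exists (perm_one_line p) a231.
  exists F => //; apply/hL; rewrite -eF; split=> //; first by apply/(@av1423P _ 1); rewrite -eF.
  by rewrite -(size_word F 1) -eF (perm_size (perm_one_line p)) size_iota.
move=> F /hL[tF aF nF] ->; have := perm_word F 1; rewrite nF => /one_line_surj[p ep].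
exists p => //; rewrite mem_enum inE; apply/and4P; split=> //.
- by apply/uniquely_sortedP; rewrite ?ep.
- by apply/contains231P; rewrite ep; apply: av231_word.
- by apply/contains1423P; rewrite ep; apply/av1423P.
Qed.

Theorem theorem5p6 (k : nat) :
  ((#|uniquely_sorted_avoiding (2 * k + 1) [:: [:: 2; 3; 1]; [:: 1; 4; 2; 3]]|)%N%:R
   = ((2 * k + 1)%N%:R)^-1 * ('C(3 * k, k))%N%:R :> rat)%R.
Proof.
have -> : #|uniquely_sorted_avoiding (2 * k + 1) [:: [:: 2; 3; 1]; [:: 1; 4; 2; 3]]| =
    ternary k 1.
  have n0 : 0 < 2 * k + 1 by rewrite addn1.
  (* The forests of [good_forests] have at least three nodes, so the one-node case is settled
     separately. *)
  case: k n0 => [|k] n0.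
    rewrite (@card_uniquely_sorted_avoiding _ [:: [:: leaf]]) // => F.
    split; first by rewrite inE => /eqP->; split=> //; apply: tight_leaf.
    by case=> _ _ /nodes_eq1->; rewrite inE.
  rewrite (card_uniquely_sorted_avoiding n0 (uniq_good_forests k)) ?size_good_forests // => F.
  rewrite mem_good_forests; have -> : 2 * k.+1 + 1 = k.*2.+3 by lia.
  by [].
rewrite -ternary1_bin GRing.natrM GRing.mulKf // Num.Theory.pnatr_eq0 addn1 //.
Qed.
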